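(* Let $\Phi:(\mathcal{S},g)\to(\mathcal{M},\bar g)$ be an isometric immersion of an $n$-dimensional Riemannian manifold into a Lorentzian manifold of signature $(-,+,\dots,+)$ with co-dimension $2$, and assume that there exists an umbilical direction (i.e. $\mathcal{S}$ is umbilical with respect to a non-zero normal vector). Let $G$ be the normal vector, determined up to sign, for which there is a self-adjoint operator $\widetilde A$ on the tangent space with $\mathrm{tr}(\widetilde A^2)=n^2$ and $\widetilde h(X,Y)=g(\widetilde AX,Y)\,G$ for all tangent $X,Y$, so that $\star^\perp G$ spans the umbilical direction if $G\neq0$. Let $\{k,\ell\}$ be a null frame of the normal bundle with $\bar g(k,k)=\bar g(\ell,\ell)=0$, $\bar g(k,\ell)=-1$. Then $$\bar g(\star^\perp G,\star^\perp G)=-\frac1{n^2}\mathrm{tr}(\mathcal{J})=\frac2{n^2}\langle\widetilde A_k,\widetilde A_\ell\rangle=-\frac1{n^2}\bigl(\mathrm{tr}(\mathcal{B})-n\,\bar g(H,H)\bigr).$$ Consequently: - if $\langle\widetilde A_k,\widetilde A_\ell\rangle<0$, equivalently $\mathrm{tr}(\mathcal{J})>0$, equivalently $\mathrm{tr}(\mathcal{B})>n\,\bar g(H,H)$, then $\star^\perp G$ is timelike; - if $\langle\widetilde A_k,\widetilde A_\ell\rangle>0$, equivalently $\mathrm{tr}(\mathcal{J})<0$, equivalently $\mathrm{tr}(\mathcal{B})<n\,\bar g(H,H)$, then $\star^\perp G$ is spacelike; - if $\langle\widetilde A_k,\widetilde A_\ell\rangle=0$, equivalently $\mathrm{tr}(\mathcal{J})=0$,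 equivalently $\mathrm{tr}(\mathcal{B})=n\,\bar g(H,H)$, then $\star^\perp G$ is null.
   Context: $\mathcal{S}$ is an orientable $n$-manifold, $\mathcal{M}$ an oriented Lorentzian $(n+2)$-manifold with metric $\bar g$, and $g=\Phi^\star\bar g$ is positive definite, so the normal bundle has signature $(-,+)$; $\mathcal{S}$ is locally identified with $\Phi(\mathcal{S})$. All statements are pointwise on $\mathcal{S}$. A normal vector $v$ is called timelike, spacelike, null according to $\bar g(v,v)<0$, $>0$, $=0$ (here $v=0$ is allowed in the null case). The second fundamental form $h$ is the normal part of $\overline\nabla_XY$ ($\overline\nabla$ the Levi-Civita connection of $\bar g$). The shape operator $A_\xi$ is defined by $g(A_\xi X,Y)=\bar g(h(X,Y),\xi)$; $H=\frac1n\sum_i h(e_i,e_i)$ for an orthonormal tangent frame; $\theta_\xi=\mathrm{tr}(A_\xi)$. The total shear tensor is $\widetilde h(X,Y)=h(X,Y)-g(X,Y)H$ and the shear operator is $\widetilde A_\xi=A_\xi-\frac1n\theta_\xi\mathbf 1$. For an orthonormal normal frame $\{\xi_1,\xi_2\}$, the Casorati operator is $\mathcal{B}=\sum_{i}\bar g(\xi_i,\xi_i)A_{\xi_i}^2$ and $\mathcal{J}=\sum_i\bar g(\xi_i,\xi_i)\widetilde A_{\xi_i}^2$ (both independent of the frame). $\langle A,B\rangle=\mathrm{tr}(AB)$ for self-adjoint operators. $\mathcal{S}$ is umbilical with respect to a normal $\xi$ if $A_\xi$ is proportional to the identity. When an umbilical direction exists, a pair $(\widetilde A,G)$ as in the claim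 exists. With $\omega^\perp$ the volume form on the normal bundle induced by the orientations and metrics, $\star^\perp\xi$ is defined by $\bar g(\star^\perp\xi,\eta)=\omega^\perp(\xi,\eta)$ for all normal $\eta$. *)

(* Defs.v *)
From HB Require Import structures.
From mathcomp Require Import all_boot all_order all_algebra.
From mathcomp Require Import all_classical all_reals all_analysis.

Set Implicit Arguments.
Unset Strict Implicit.
Unset Printing Implicit Defensive.
Import Order.TTheory GRing.Theory Num.Theory.
Import numFieldNormedType.Exports.
Local Open Scope classical_set_scope.
Local Open Scope ring_scope.

(* Coordinate vectors are ROW vectors: a bilinear form with matrix G is
   (u, v) |-> u G v^T, an operator with matrix A is X |-> X A, and the rows of
   the (library) Jacobian of F are the partial derivatives of F. *)

(** * Smooth manifolds *)

Fixpoint Ck (R : realType) (n : nat) (W : normedModType R) (k : nat)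
    (U : set 'rV[R]_n) (f : 'rV[R]_n -> W) : Prop :=
  match k with
  | 0%N => forall x, U x -> {for x, continuous f}
  | k'.+1 => (forall x, U x -> differentiable f x) /\
             (forall i : 'I_n, Ck k' U (fun x => 'D_(delta_mx 0 i) f x))
  end.

Definition smooth_on (R : realType) (n : nat) (W : normedModType R)
    (U : set 'rV[R]_n) (f : 'rV[R]_n -> W) : Prop := forall k, Ck k U f.

Record manifold (R : realType) (n : nat) (T : topologicalType) := Manifold {
  chart_index : Type;
  chart_dom : chart_index -> set T;
  chart : chart_index -> T -> 'rV[R]_n;
  chart_inv : chart_index -> 'rV[R]_n -> T;
  manifold_hausdorff : hausdorff_space T;
  manifold_second_countable : @second_countable T;
  chart_cover : forall p, exists i, chart_dom i p;
  chart_dom_open : forall i, open (chart_dom i);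
  chart_img_open : forall i, open (chart i @` chart_dom i);
  chart_invK : forall i p, chart_dom i p -> chart_inv i (chart i p) = p;
  chart_continuous : forall i p, chart_dom i p -> {for p, continuous (chart i)};
  chart_inv_continuous : forall i x, (chart i @` chart_dom i) x ->
    {for x, continuous (chart_inv i)};
  chart_smooth : forall i j,
    smooth_on (chart i @` (chart_dom i `&` chart_dom j))
              (chart j \o chart_inv i) }.

Section Manifolds.
Variables (R : realType) (n m : nat) (S M : topologicalType).
Variables (mS : manifold R n S) (mM : manifold R m M).

Definition transition (i j : chart_index mS) : 'rV[R]_n -> 'rV[R]_n :=
  chart j \o chart_inv i.

(* An orientation is given as an oriented atlas: every chart is positive. *)
Definition oriented : Prop :=
  forall i j x, (chart i @` (chart_dom i `&` chart_dom j)) x ->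
  0 < \det (jacobian (transition i j) x).

Definition local_rep (Phi : S -> M) (i : chart_index mS) (j : chart_index mM)
  : 'rV[R]_n -> 'rV[R]_m := chart j \o Phi \o chart_inv i.

Definition smooth_map (Phi : S -> M) : Prop :=
  continuous Phi /\
  forall i j, smooth_on (chart i @` (chart_dom i `&` Phi @^-1` chart_dom j))
                        (local_rep Phi i j).

End Manifolds.

(* A field of symmetric bilinear forms, given by its components in each chart. *)
Record metric (R : realType) (n : nat) (T : topologicalType)
    (mT : manifold R n T) := Metric {
  gmx : chart_index mT -> 'rV[R]_n -> 'M[R]_n;
  metric_smooth : forall i, smooth_on (chart i @` chart_dom i) (gmx i);
  metric_sym : forall i x, (chart i @` chart_dom i) x -> (gmx i x)^T = gmx i x;
  metric_compat : forall i j x,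
    (chart i @` (chart_dom i `&` chart_dom j)) x ->
    gmx i x = jacobian (transition i j) x *m gmx j (transition i j x)
              *m (jacobian (transition i j) x)^T }.

Section Metrics.
Variable R : realType.

Definition inner (m : nat) (G : 'M[R]_m) (u v : 'rV[R]_m) : R :=
  (u *m G *m v^T) 0 0.

Lemma inner_sym (m : nat) (G : 'M[R]_m) (u v : 'rV[R]_m) : G^T = G ->
  inner G u v = inner G v u.
Proof.
move=> GT; rewrite /inner -[u *m G *m v^T]trmxK mxE.
by congr (fun_of_matrix _ _ _); rewrite !trmx_mul trmxK GT mulmxA.
Qed.

Definition positive_definite (m : nat) (G : 'M[R]_m) : Prop :=
  forall u : 'rV[R]_m, u != 0 -> 0 < inner G u u.

(* Signature (-,+,...,+). *)
Definition lorentzian_form (m : nat) (G : 'M[R]_m) : Prop :=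
  exists2 P : 'M[R]_m, P \in unitmx &
    P *m G *m P^T = diag_mx (\row_(i < m) (if (i == 0 :> nat)%N then -1 else 1)).

Definition riemannian n (T : topologicalType) (mT : manifold R n T)
    (g : metric mT) : Prop :=
  forall i x, (chart i @` chart_dom i) x -> positive_definite (gmx g i x).

Definition lorentzian n (T : topologicalType) (mT : manifold R n T)
    (g : metric mT) : Prop :=
  forall i x, (chart i @` chart_dom i) x -> lorentzian_form (gmx g i x).

(* Components of F^* gb at x. *)
Definition pullback (n m : nat) (gb : 'rV[R]_m -> 'M[R]_m)
    (F : 'rV[R]_n -> 'rV[R]_m) (x : 'rV[R]_n) : 'M[R]_n :=
  jacobian F x *m gb (F x) *m (jacobian F x)^T.

Definition isometric_immersion (n m : nat) (S M : topologicalType)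
    (mS : manifold R n S) (mM : manifold R m M)
    (g : metric mS) (gb : metric mM) (Phi : S -> M) : Prop :=
  smooth_map mS mM Phi /\
  forall i j x, (chart i @` (chart_dom i `&` Phi @^-1` chart_dom j)) x ->
    row_free (jacobian (local_rep Phi i j) x) /\
    gmx g i x = pullback (gmx gb j) (local_rep Phi i j) x.

(** * Levi-Civita connection and second fundamental form, in coordinates *)

(* The Christoffel symbols of gb at y as a vector-valued bilinear map: for
   constant fields u, v, w the Koszul formula reads
   2 gb (Gamma(u,v), w) = D_u gb(v,w) + D_v gb(u,w) - D_w gb(u,v). *)
Definition christoffel (m : nat) (gb : 'rV[R]_m -> 'M[R]_m)
    (y u v : 'rV[R]_m) : 'rV[R]_m :=
  (2%:R^-1 *: \row_(d < m) (inner ('D_u gb y) v (delta_mx 0 d)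
                            + inner ('D_v gb y) u (delta_mx 0 d)
                            - inner ('D_(delta_mx 0 d) gb y) u v))
  *m invmx (gb y).

(* Covariant derivative, in the direction X at x, of a field V along F. *)
Definition covariant_along (n m : nat) (gb : 'rV[R]_m -> 'M[R]_m)
    (F : 'rV[R]_n -> 'rV[R]_m) (x X : 'rV[R]_n)
    (V : 'rV[R]_n -> 'rV[R]_m) : 'rV[R]_m :=
  'D_X V x + christoffel gb (F x) ('D_X F x) (V x).

(* Component of v orthogonal to the row space of D (the tangent space), gt
   being the metric induced on the latter: v^a - gt^ij gb(v, D_i) D_j^a. *)
Definition normal_part (n m : nat) (gt : 'M[R]_n) (gn : 'M[R]_m)
    (D : 'M[R]_(n, m)) (v : 'rV[R]_m) : 'rV[R]_m :=
  v - v *m gn *m D^T *m invmx gt *m D.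

(* Normal part of the derivative along X of the tangent field dF(Y), where Y
   is extended as a constant field in the chart; the result does not depend on
   the extension. *)
Definition second_fundamental_form (n m : nat) (gb : 'rV[R]_m -> 'M[R]_m)
    (F : 'rV[R]_n -> 'rV[R]_m) (x X Y : 'rV[R]_n) : 'rV[R]_m :=
  normal_part (pullback gb F x) (gb (F x)) (jacobian F x)
    (covariant_along gb F x X (fun z => 'D_Y F z)).

(** * Pointwise extrinsic quantities

   gt : metric of the tangent space of S; gn : metric of the tangent space
   of M; D : differential of the immersion; h : second fundamental form. *)

Section Pointwise.
Variables (n m : nat) (gt : 'M[R]_n) (gn : 'M[R]_m) (D : 'M[R]_(n, m)).
Variable h : 'rV[R]_n -> 'rV[R]_n -> 'rV[R]_m.

Definition normal_vector (v : 'rV[R]_m) : Prop :=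
  forall X : 'rV[R]_n, inner gn (X *m D) v = 0.

(* The rows of e form an orthonormal tangent frame. *)
Definition orthonormal_frame (e : 'M[R]_n) : Prop :=
  forall i j, inner gt (row i e) (row j e) = (i == j)%:R.

Definition orthonormal_normal_frame (xi1 xi2 : 'rV[R]_m) : Prop :=
  [/\ normal_vector xi1, normal_vector xi2, inner gn xi1 xi2 = 0,
      `|inner gn xi1 xi1| = 1 & `|inner gn xi2 xi2| = 1].

Definition null_normal_frame (k l : 'rV[R]_m) : Prop :=
  [/\ normal_vector k, normal_vector l, inner gn k k = 0,
      inner gn l l = 0 & inner gn k l = -1].

Definition timelike (v : 'rV[R]_m) : Prop := inner gn v v < 0.
Definition spacelike (v : 'rV[R]_m) : Prop := 0 < inner gn v v.
Definition null (v : 'rV[R]_m) : Prop := inner gn v v = 0.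

Definition self_adjoint (A : 'M[R]_n) : Prop :=
  forall X Y : 'rV[R]_n, inner gt (X *m A) Y = inner gt X (Y *m A).

Definition op_inner (A B : 'M[R]_n) : R := \tr (A *m B).

Definition shape_operator (xi : 'rV[R]_m) : 'M[R]_n :=
  (\matrix_(i, j) inner gn (h (delta_mx 0 i) (delta_mx 0 j)) xi) *m invmx gt.

(* The defining property gt (A_xi X, Y) = gn (h (X, Y), xi). *)
Lemma shape_operatorP (xi : 'rV[R]_m) : gt \in unitmx ->
  (forall X Y, inner gn (h X Y) xi =
    \sum_i \sum_j X 0 i * Y 0 j *
      inner gn (h (delta_mx 0 i) (delta_mx 0 j)) xi) ->
  forall X Y, inner gt (X *m shape_operator xi) Y = inner gn (h X Y) xi.
Proof.
move=> gtU hbil X Y; rewrite hbil /shape_operator.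
set s := \matrix_(i, j) _; rewrite {1}/inner -!mulmxA mulKmx //.
rewrite mxE; apply: eq_bigr => i _; rewrite mxE big_distrr /=.
by apply: eq_bigr => j _; rewrite [s i j]mxE [Y^T j 0]mxE -mulrA (mulrC (Y 0 j)).
Qed.

Lemma normal_part_normal (v : 'rV[R]_m) : gn^T = gn -> gt \in unitmx ->
  gt = D *m gn *m D^T -> normal_vector (normal_part gt gn D v).
Proof.
move=> gnT gtU gtE X; rewrite inner_sym // /inner /normal_part trmx_mul.
rewrite !mulmxBl -!mulmxA 2!(mulmxA gn) (mulmxA D) mulmxA -gtE.
by rewrite mulKmx // subrr mxE.
Qed.

Definition expansion (xi : 'rV[R]_m) : R := \tr (shape_operator xi).

Definition shear_operator (xi : 'rV[R]_m) : 'M[R]_n :=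
  shape_operator xi - (n%:R^-1 * expansion xi)%:M.

Definition mean_curvature (e : 'M[R]_n) : 'rV[R]_m :=
  n%:R^-1 *: \sum_(i < n) h (row i e) (row i e).

Definition total_shear (e : 'M[R]_n) (X Y : 'rV[R]_n) : 'rV[R]_m :=
  h X Y - inner gt X Y *: mean_curvature e.

Definition casorati (xi1 xi2 : 'rV[R]_m) : 'M[R]_n :=
  inner gn xi1 xi1 *: (shape_operator xi1 *m shape_operator xi1)
  + inner gn xi2 xi2 *: (shape_operator xi2 *m shape_operator xi2).

Definition shear_casorati (xi1 xi2 : 'rV[R]_m) : 'M[R]_n :=
  inner gn xi1 xi1 *: (shear_operator xi1 *m shear_operator xi1)
  + inner gn xi2 xi2 *: (shear_operator xi2 *m shear_operator xi2).

Definition umbilical (xi : 'rV[R]_m) : Prop :=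
  exists c : R, shape_operator xi = c%:M.

(* The normal vector G of the factorisation h~(X, Y) = gt (A X, Y) G. *)
Definition shear_vector (e : 'M[R]_n) (G : 'rV[R]_m) : Prop :=
  normal_vector G /\
  exists A : 'M[R]_n, [/\ self_adjoint A, \tr (A *m A) = n%:R ^+ 2 &
    forall X Y, total_shear e X Y = inner gt (X *m A) Y *: G].

End Pointwise.

Section NormalHodge.
Variables (n : nat) (gt : 'M[R]_n) (gn : 'M[R]_n.+2) (D : 'M[R]_(n, n.+2)).

(* Volume form of the normal bundle, in positive charts: the volume form of M
   evaluated on (E_1, ..., E_n, xi, eta) for a positive orthonormal tangent
   frame E, rewritten on the coordinate frame D of the tangent space. *)
Definition normal_volume (xi eta : 'rV[R]_n.+2) : R :=
  Num.sqrt `|\det gn| / Num.sqrt (\det gt) *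
  \det (castmx (addn2 n, erefl n.+2) (col_mx D (col_mx xi eta))).

(* normal_volume xi eta vanishes for eta tangent, so that raising an index of
   normal_volume xi with the full metric gn yields a normal vector. *)
Definition normal_hodge (xi : 'rV[R]_n.+2) : 'rV[R]_n.+2 :=
  (\row_j normal_volume xi (delta_mx 0 j)) *m invmx gn.

Lemma normal_volumeE xi eta : normal_volume xi eta =
  \sum_j eta 0 j * normal_volume xi (delta_mx 0 j).
Proof.
rewrite /normal_volume; set c := _ / _.
pose B eta := castmx (addn2 n, erefl n.+2) (col_mx D (col_mx xi eta)).
have Bl a j : B a ord_max j = a 0 j.
  rewrite castmxE /= (_ : cast_ord _ _ = rshift n (rshift 1 0)); last first.
    by apply: val_inj => /=; rewrite addn1.
  by rewrite col_mxEd cast_ord_id (@col_mxEd _ 1 1).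
have cof a b j : cofactor (B a) ord_max j = cofactor (B b) ord_max j.
  rewrite /cofactor; congr (_ * \det _); apply/matrixP => i k; rewrite !mxE.
  rewrite !castmxE !mxE; case: splitP => i' //= Hi; rewrite !mxE.
  case: splitP => //= i2 Hi2.
  move: Hi; rewrite Hi2 (ord1 i2) /= /bump leqNgt ltn_ord /= => Hi.
  by have := ltn_ord i; rewrite /= -[X in (X < _)%N]add0n Hi addn1 ltnn.
rewrite (expand_det_row (B eta) ord_max) big_distrr; apply: eq_bigr => j _ /=.
rewrite Bl mulrCA; congr (_ * (_ * _)).
rewrite (expand_det_row (B (delta_mx 0 j)) ord_max) (bigD1 j) //= big1 ?addr0.
  by rewrite Bl mxE !eqxx mul1r; apply: cof.
by move=> k /negbTE kj; rewrite Bl mxE kj andbF mul0r.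
Qed.

(* The defining property of the Hodge operator. *)
Lemma normal_hodgeP xi eta : gn \in unitmx ->
  inner gn (normal_hodge xi) eta = normal_volume xi eta.
Proof.
move=> u; rewrite normal_volumeE /inner /normal_hodge mulmxKV // mxE.
by apply: eq_bigr => j _; rewrite !mxE mulrC.
Qed.

Lemma det_cast0 p q (E : p = q) (w : 'rV[R]_p) (N : 'M[R]_(p, q)) :
  w != 0 -> w *m N = 0 -> \det (castmx (E, erefl q) N) = 0.
Proof. by subst q => w0 wN; rewrite castmx_id; apply/eqP/det0P; exists w. Qed.

Lemma normal_hodge_normal xi : gn^T = gn -> gn \in unitmx ->
  normal_vector gn D (normal_hodge xi).
Proof.
move=> sgn ugn X.
rewrite inner_sym // normal_hodgeP // /normal_volume.
rewrite [X in _ * X](_ : _ = 0) ?mulr0 //.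
pose w : 'rV[R]_(n + (1 + 1)) := row_mx X (row_mx 0 (- 1%:M)).
apply: (@det_cast0 _ _ _ w); rewrite /w.
  rewrite !row_mx_eq0 oppr_eq0; apply/negP => /andP[_ /andP[_ /eqP/matrixP/(_ 0 0)]].
  by rewrite !mxE => /eqP; rewrite oner_eq0.
by rewrite !mul_row_col mul0mx add0r mulNmx mul1mx subrr.
Qed.

End NormalHodge.

End Metrics.

(* Main.v *)
Require Import Defs.
From mathcomp Require Import all_boot all_order all_algebra.
From mathcomp Require Import all_classical all_reals all_analysis.
From mathcomp Require Import ring lra.

(** The pointwise statement is linear algebra in the normal plane, once the
    second fundamental form is known to be bilinear, symmetric and normal.
    Symmetry is where analysis enters: it rests on the equality of mixed second
    derivatives.

    On normal vectors the Gram determinant of (D, u, v) gives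
    vol(u,v)^2 = <u,v>^2 - <u,u><v,v>; hence the normal plane is Lorentzian and
    the Hodge operator satisfies <*u,u> = 0 and <*u,*u> = -<u,u>, so that the
    normal vectors orthogonal to u <> 0 are the multiples of *u. If xi is
    umbilical, the total shear takes values in the line orthogonal to xi, which
    gives G. Conversely the factorisation says that the shear operator of xi is
    <G,xi> A; as tr A^2 = n^2, the traces of the theorem reduce to n^2 <G,G>,
    expanded in a null or in an orthonormal frame. *)

Set Implicit Arguments.
Unset Strict Implicit.

Import Order.TTheory GRing.Theory Num.Theory.
Import numFieldNormedType.Exports.
Local Open Scope classical_set_scope.
Local Open Scope ring_scope.

(** * Equality of mixed second derivatives *)

(** The little-o of differentiability in epsilon form, which the estimates of [second_difference]
    need. *)
Lemma differentiable_remainder (R : realType) (V W : normedModType R)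
    (f : V -> W) (x : V) (e : R) : differentiable f x -> 0 < e ->
  \forall h \near 0, `|f (h + x) - f x - 'd f x h| <= e * `|h|.
Proof.
move=> /diff_locally /eqaddoP H e0; have := H _ e0.
apply: filter_app; near=> h => /=.
rewrite -![(_ - _ : _ -> _) _]/(_ - _) -![(_ + _ : _ -> _) _]/(_ + _) /=.
by rewrite opprD addrA.
Unshelve. all: by end_near. Qed.

(** Turns a directional derivative into a derivative in one real variable, so that the mean value
    theorem applies along the line. *)
Lemma is_derive_line (R : realType) (V W : normedModType R) (f : V -> W)
    (u w : V) (s : R) : differentiable f (s *: u + w) ->
  is_derive s 1 (fun t : R => f (t *: u + w)) ('D_u f (s *: u + w)).
Proof.
move=> df; have /derivableP [H1 H2] := @diff_derivable _ _ _ f _ u df.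
have E : (fun h : R => h^-1 *: (((fun t : R => f (t *: u + w)) \o shift s) (h *: 1)
    - f (s *: u + w))) =
  (fun h : R => h^-1 *: ((f \o shift (s *: u + w)) (h *: u) - f (s *: u + w))).
  apply/funext => h /=; congr (_ *: (f _ - _)).
  by rewrite [h *: 1]mulr1 scalerDl addrA.
by split; rewrite /derivable /derive E.
Qed.

(* The mean value theorem applied to s |-> f(x+su+tv) - f(x+su) on [0,t] reduces
   the second difference to an increment of D_u f, which only needs to be
   differentiable at x. *)
Lemma second_difference (R : realType) (V : normedModType R)
    (f g : V -> R) (x u v : V) (e : R) : 0 < e ->
  (\forall z \near x, differentiable f z /\ 'D_u f z = g z) ->
  differentiable g x ->
  \forall t \near 0^'+,
    `|f (t *: u + (t *: v + x)) - f (t *: u + x) - f (t *: v + x) + f x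
      - t ^+ 2 * 'D_v g x| <= e * t ^+ 2.
Proof.
move=> e0 df dg.
(* The summand 1 keeps [C] positive when [u = v = 0]. With the tolerance [e / (2 * C)], the
   remainder at displacements of norm at most [t * C] is at most [e / 2 * t]; two such remainders
   occur. *)
pose C := `|u| + `|v| + 1.
have C0 : 0 < C by rewrite /C ltr_wpDl // addr_ge0.
have e10 : 0 < e / (2 * C) by rewrite divr_gt0 // mulr_gt0.
have /nbhs_ballP[d1 /= d10 Hd1] := df.
have /nbhs_ballP[d2 /= d20 Hd2] := differentiable_remainder dg e10.
near=> t.
have t0 : 0 < t by near: t; exact: nbhs_right_gt.
have tC1 : t * C < d1.
  rewrite -ltr_pdivlMr //; near: t; apply: nbhs_right_lt; exact: divr_gt0.
have tC2 : t * C < d2.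
  rewrite -ltr_pdivlMr //; near: t; apply: nbhs_right_lt; exact: divr_gt0.
have sm a b : 0 <= a <= t -> 0 <= b <= t -> `|a *: u + b *: v| <= t * (`|u| + `|v|).
  move=> /andP[a0 at_] /andP[b0 bt]; rewrite (le_trans (ler_normD _ _)) // !normrZ.
  by rewrite mulrDr lerD // ler_wpM2r // ger0_norm.
have tC : t * (`|u| + `|v|) <= t * C by rewrite (ler_wpM2l (ltW t0)) // /C ler_wpDr.
have dfs a b : 0 <= a <= t -> 0 <= b <= t -> differentiable f (a *: u + (b *: v + x)) /\
    'D_u f (a *: u + (b *: v + x)) = g (a *: u + (b *: v + x)).
  move=> ha hb; apply: Hd1; rewrite -ball_normE /= addrA opprD addrCA subrr addr0 normrN.
  by rewrite (le_lt_trans (sm _ _ ha hb)) // (le_lt_trans tC).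
have gs a b : 0 <= a <= t -> 0 <= b <= t ->
   `|g (a *: u + (b *: v + x)) - g x - (a * 'd g x u + b * 'd g x v)|
     <= e / 2 * t.
  move=> ha hb.
  have /Hd2 : ball 0 d2 (a *: u + b *: v).
    rewrite -ball_normE /= sub0r normrN.
    by rewrite (le_lt_trans (sm _ _ ha hb)) // (le_lt_trans tC).
  have -> : a * 'd g x u + b * 'd g x v = 'd g x (a *: u + b *: v).
    by rewrite linearD !linearZ.
  rewrite (addrA (a *: u)) => H; apply: (le_trans H).
  apply: (@le_trans _ _ (e / (2 * C) * (t * C))).
    by rewrite ler_pM2l // (le_trans (sm _ _ ha hb)).
  rewrite le_eqVlt; apply/orP; left; apply/eqP.
  by field; rewrite gt_eqF.
have tt0 : 0 <= (0 : R) <= t by rewrite lexx ltW.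
have ttt : 0 <= t <= t by rewrite lexx ltW.
pose phi s := f (s *: u + (t *: v + x)) - f (s *: u + x).
have dphi s : 0 <= s <= t ->
    is_derive s 1 phi (g (s *: u + (t *: v + x)) - g (s *: u + x)).
  move=> hs; have [/is_derive_line H1 E1] := dfs _ _ hs ttt.
  have := dfs _ _ hs tt0; rewrite scale0r add0r => -[/is_derive_line H2 E2].
  rewrite E1 in H1; rewrite E2 in H2.
  exact: is_deriveB.
have [|||s hs] := @MVT R phi (fun s => g (s *: u + (t *: v + x)) - g (s *: u + x)) 0 t.
- by [].
- by move=> s; rewrite in_itv /= => /andP[s0 st]; apply: dphi; rewrite !ltW.
- apply: derivable_within_continuous => s; rewrite in_itv /= => hs.
  exact: (@ex_derive _ _ _ _ _ _ _ (dphi s hs)).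
rewrite /phi !scale0r !add0r subr0 => Hs.
have hs' : 0 <= s <= t by move: hs; rewrite in_itv /= => /andP[? ?]; rewrite !ltW.
have G1 := gs _ _ hs' ttt.
have G2 := gs _ _ hs' tt0; rewrite scale0r add0r mul0r addr0 in G2.
rewrite deriveE //.
have -> : f (t *: u + (t *: v + x)) - f (t *: u + x) - f (t *: v + x) + f x =
   (f (t *: u + (t *: v + x)) - f (t *: u + x)) - (f (t *: v + x) - f x) by ring.
rewrite Hs; set a := g _ in G1 *; set b := g _ in G2 *.
set l1 := 'd g x u in G1 G2; set l2 := 'd g x v in G1 *.
(* The contribution [s * l1] of the unknown intermediate point cancels, leaving two remainders
   bounded by [G1] and [G2]. *)
have -> : (a - b) * t - t ^+ 2 * l2 =
   t * ((a - g x - (s * l1 + t * l2)) - (b - g x - s * l1)) by ring.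
rewrite normrM (ger0_norm (ltW t0)).
have -> : e * t ^+ 2 = t * (e / 2 * t + e / 2 * t) by field.
by rewrite ler_pM2l // (le_trans (ler_normB _ _)) // lerD.
Unshelve. all: by end_near. Qed.

(** The second difference is symmetric in [u] and [v], and [t ^+ 2] times either mixed derivative
    approximates it up to [e / 2 * t ^+ 2]. Dividing by [t ^+ 2] shows that the two differ by at
    most any [e > 0]. *)
Lemma derive_swap_real (R : realType) (V : normedModType R)
    (f fu fv : V -> R) (x u v : V) :
  (\forall z \near x, [/\ differentiable f z, 'D_u f z = fu z & 'D_v f z = fv z]) ->
  differentiable fu x -> differentiable fv x ->
  'D_v fu x = 'D_u fv x.
Proof.
move=> df du dv; apply/eqP; rewrite -subr_eq0 -normr_le0; apply/ler_addgt0Pr => e e0.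
rewrite add0r; have e20 : 0 < e / 2 by rewrite divr_gt0.
have [t [t0 H1 H2]] : exists t : R, [/\ 0 < t,
   `|f (t *: u + (t *: v + x)) - f (t *: u + x) - f (t *: v + x) + f x
      - t ^+ 2 * 'D_v fu x| <= e / 2 * t ^+ 2 &
   `|f (t *: v + (t *: u + x)) - f (t *: v + x) - f (t *: u + x) + f x
      - t ^+ 2 * 'D_u fv x| <= e / 2 * t ^+ 2].
  near (0 : R)^'+ => t; exists t; split; near: t; first exact: nbhs_right_gt.
    apply: second_difference => //; by apply: filterS df => z [].
  apply: second_difference => //; by apply: filterS df => z [].
rewrite (addrCA (t *: v)) in H2.
set d := f _ in H1 H2; set du' := 'D_v _ _ in H1 *; set dv' := 'D_u _ _ in H2 *.
rewrite -(ler_pM2l (exprn_gt0 2 t0)) -{1}(ger0_norm (ltW (exprn_gt0 2 t0))) -normrM.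
set a := f _ in H1 H2; set b := f _ in H1 H2.
have -> : t ^+ 2 * (du' - dv') =
   (d - b - a + f x - t ^+ 2 * dv') - (d - a - b + f x - t ^+ 2 * du') by ring.
rewrite (le_trans (ler_normB _ _)) // (le_trans (lerD H2 H1)) //.
by rewrite -mulrDl -splitr mulrC.
Unshelve. all: by end_near. Qed.

Lemma differentiable_coordinate (R : realType) (V : normedModType R) m
    (f : V -> 'rV[R]_m) (x : V) k :
  differentiable f x -> differentiable (fun z => f z 0 k : R) x.
Proof.
move=> df; apply: (@differentiable_comp _ _ _ _ f (fun N : 'rV[R]_m => N 0 k : R)) => //.
exact: differentiable_coord.
Qed.

Lemma derive_coordinate (R : realType) (V : normedModType R) p m
    (f : V -> 'M[R]_(p, m)) (x v : V) i k :
  derivable f x v -> ('D_v f x) i k = 'D_v (fun z => f z i k) x.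
Proof. by move=> df; rewrite derive_mx // mxE. Qed.

Lemma derive_swap (R : realType) (V : normedModType R) m
    (f : V -> 'rV[R]_m) (x u v : V) :
  (\forall z \near x, differentiable f z) ->
  differentiable (fun z => 'D_u f z) x -> differentiable (fun z => 'D_v f z) x ->
  'D_v (fun z => 'D_u f z) x = 'D_u (fun z => 'D_v f z) x.
Proof.
move=> df du dv; apply/rowP => k.
have E (f' : V -> 'rV[R]_m) w : differentiable f' x ->
    ('D_w f' x) 0 k = 'D_w (fun z => f' z 0 k) x.
  by move=> /(@diff_derivable _ _ _ _ _ w); exact: derive_coordinate.
apply: (etrans (E _ v du)); apply/esym; apply: (etrans (E _ u dv)); apply/esym.
apply: (@derive_swap_real _ _ (fun z => f z 0 k)); try exact: differentiable_coordinate.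
apply: filterS df => z dz; split; first exact: differentiable_coordinate.
  exact/esym/derive_coordinate/diff_derivable.
exact/esym/derive_coordinate/diff_derivable.
Qed.

Lemma derive_linear (R : realType) (V W : normedModType R) (f : V -> W) (x : V)
    (a : R) (u v : V) : differentiable f x ->
  'D_(a *: u + v) f x = a *: 'D_u f x + 'D_v f x.
Proof. by move=> df; rewrite !deriveE // linearP. Qed.

Lemma derive_row_sum (R : realType) n (W : normedModType R)
    (f : 'rV[R]_n -> W) (x u : 'rV[R]_n) : differentiable f x ->
  'D_u f x = \sum_i u 0 i *: 'D_(delta_mx 0 i) f x.
Proof.
move=> df; rewrite deriveE // {1}(row_sum_delta u) linear_sum.
by apply: eq_bigr => i _; rewrite linearZ deriveE.
Qed.

(** * The second fundamental form is bilinear and symmetric *)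

Lemma inner_linear_l (R : realType) m (G : 'M[R]_m) a (u v w : 'rV[R]_m) :
  inner G (a *: u + v) w = a * inner G u w + inner G v w.
Proof. by rewrite /inner !mulmxDl -!scalemxAl !mxE. Qed.

Lemma inner_linear_form (R : realType) m a (G G' : 'M[R]_m) (u v : 'rV[R]_m) :
  inner (a *: G + G') u v = a * inner G u v + inner G' u v.
Proof. by rewrite /inner mulmxDr mulmxDl -scalemxAr -!scalemxAl !mxE. Qed.

Section SecondDerivative.
Variables (R : realType) (n m : nat) (F : 'rV[R]_n -> 'rV[R]_m) (x : 'rV[R]_n).
Hypothesis dF : \forall z \near x, differentiable F z.
Hypothesis ddF : forall i, differentiable (fun z => 'D_(delta_mx 0 i) F z) x.

(** Differentiability is assumed for the partial derivatives only, so a general direction [v] is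
    expanded in the basis; the expansion holds near [x], as differentiating it again requires. *)
Lemma derive2_row_sum (u v : 'rV[R]_n) :
  'D_u (fun z => 'D_v F z) x =
  \sum_i v 0 i *: 'D_u (fun z => 'D_(delta_mx 0 i) F z) x.
Proof.
pose g i := v 0 i *: (fun z => 'D_(delta_mx 0 i) F z).
have E : \forall z \near x, 'D_v F z = (\sum_i g i) z.
  by apply: filterS dF => z dz; rewrite derive_row_sum // fct_sumE.
have dg i : derivable (fun z => 'D_(delta_mx 0 i) F z) x u.
  exact/diff_derivable/ddF.
apply: etrans (near_eq_derive _ E) _; rewrite derive_sum => [|i]; last exact: derivableZ.
by apply: eq_bigr => i _; rewrite deriveZ.
Qed.

Lemma derive2_linear a (u v w : 'rV[R]_n) :
  'D_(a *: u + v) (fun z => 'D_w F z) x =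
  a *: 'D_u (fun z => 'D_w F z) x + 'D_v (fun z => 'D_w F z) x.
Proof.
apply: etrans (derive2_row_sum (a *: u + v) w) _.
apply: etrans _ (esym (f_equal2 (fun y z => a *: y + z)
  (derive2_row_sum u w) (derive2_row_sum v w))).
rewrite scaler_sumr -big_split; apply: eq_bigr => i _ /=.
by rewrite (derive_linear a u v (ddF i)) scalerDr !scalerA mulrC.
Qed.

Lemma derive2_sym (u v : 'rV[R]_n) :
  'D_u (fun z => 'D_v F z) x = 'D_v (fun z => 'D_u F z) x.
Proof.
have E w w' : 'D_w (fun z => 'D_w' F z) x = \sum_i \sum_j (w' 0 i * w 0 j) *:
    'D_(delta_mx 0 j) (fun z => 'D_(delta_mx 0 i) F z) x.
  apply: etrans (derive2_row_sum w w') _; apply: eq_bigr => i _.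
  rewrite (derive_row_sum w (ddF i)) scaler_sumr.
  by apply: eq_bigr => j _; rewrite scalerA.
apply: etrans (E u v) _; apply: etrans _ (esym (E v u)).
rewrite exchange_big; apply: eq_bigr => i _; apply: eq_bigr => k _.
rewrite mulrC; apply: (congr1 (fun z => _ *: z)).
exact: derive_swap dF (ddF k) (ddF i).
Qed.

End SecondDerivative.

Section Christoffel.
Variables (R : realType) (m : nat) (gb : 'rV[R]_m -> 'M[R]_m) (y : 'rV[R]_m).
Hypothesis dgb : differentiable gb y.
Hypothesis gb_sym : \forall z \near y, (gb z)^T = gb z.

Lemma derive_metric_sym (u : 'rV[R]_m) : ('D_u gb y)^T = 'D_u gb y.
Proof.
have dg : derivable gb y u by exact: diff_derivable.
apply/matrixP => i k; rewrite mxE !derive_coordinate //; apply: near_eq_derive.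
by apply: filterS gb_sym => z E; rewrite -[in LHS]E mxE.
Qed.

(** Exchanging [u] and [v] permutes the first two Koszul terms; the third is symmetric because a
    derivative of a symmetric matrix field is symmetric. *)
Lemma christoffel_sym (u v : 'rV[R]_m) :
  christoffel gb y u v = christoffel gb y v u.
Proof.
rewrite /christoffel; congr (_ *: _ *m _); apply/rowP => d; rewrite !mxE.
rewrite [X in _ = X - _]addrC; congr (_ - _).
exact/inner_sym/derive_metric_sym.
Qed.

Lemma christoffel_linear a (u v w : 'rV[R]_m) :
  christoffel gb y (a *: u + v) w = a *: christoffel gb y u w + christoffel gb y v w.
Proof.
rewrite /christoffel !scalemxAl -mulmxDl; congr (_ *m _); apply/rowP => d.
rewrite !mxE (derive_linear a u v dgb).
move: ('D_u gb y) ('D_v gb y) ('D_(delta_mx 0 d) gb y) => Gu Gv Gd.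
by rewrite inner_linear_form !inner_linear_l; ring.
Qed.

End Christoffel.

Lemma normal_part_linear (R : realType) n m (gt : 'M[R]_n) (gn : 'M[R]_m)
    (D : 'M[R]_(n, m)) a (u v : 'rV[R]_m) :
  normal_part gt gn D (a *: u + v) = a *: normal_part gt gn D u + normal_part gt gn D v.
Proof.
rewrite /normal_part !mulmxDl -!scalemxAl scalerBr opprD.
by rewrite !addrA; congr (_ + _); rewrite addrAC.
Qed.

Section SecondFundamentalForm.
Variables (R : realType) (n m : nat) (gb : 'rV[R]_m -> 'M[R]_m).
Variables (F : 'rV[R]_n -> 'rV[R]_m) (x : 'rV[R]_n).
Hypothesis dF : \forall z \near x, differentiable F z.
Hypothesis ddF : forall i, differentiable (fun z => 'D_(delta_mx 0 i) F z) x.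
Hypothesis dgb : differentiable gb (F x).
Hypothesis gb_sym : \forall z \near F x, (gb z)^T = gb z.

Lemma second_fundamental_form_linear a (u v w : 'rV[R]_n) :
  second_fundamental_form gb F x (a *: u + v) w =
  a *: second_fundamental_form gb F x u w + second_fundamental_form gb F x v w.
Proof.
have dFx : differentiable F x by exact: nbhs_singleton dF.
rewrite /second_fundamental_form -normal_part_linear; congr normal_part.
rewrite /covariant_along (derive2_linear dF ddF a u v w) (derive_linear a u v dFx).
rewrite christoffel_linear //.
rewrite scalerDr; exact: addrACA.
Qed.

Lemma second_fundamental_form_sym (u v : 'rV[R]_n) :
  second_fundamental_form gb F x u v = second_fundamental_form gb F x v u.
Proof.
rewrite /second_fundamental_form /covariant_along (derive2_sym dF ddF u v).
by rewrite christoffel_sym.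
Qed.

End SecondFundamentalForm.

(** * Self-adjoint operators and the normal plane *)

Lemma det_mx2 (R : comNzRingType) (M : 'M[R]_2) :
  \det M = M 0 0 * M 1 1 - M 0 1 * M 1 0.
Proof.
rewrite (expand_det_row M 0) big_ord_recl big_ord1 /cofactor !det_mx11 !mxE /=.
rewrite expr0 expr1 mul1r mulN1r mulrN; congr (_ * M _ _ - M _ _ * M _ _); exact: val_inj.
Qed.

(** Gram determinant identity; the cast accounts for [n + 2] and [n.+2] being different types of
    sizes. *)
Lemma det_castmx_gram (R : comNzRingType) p q (E : p = q)
    (N : 'M[R]_(p, q)) (G : 'M[R]_q) :
  \det (castmx (E, erefl q) N) ^+ 2 * \det G = \det (N *m G *m N^T).
Proof. by subst q; rewrite castmx_id !det_mulmx det_tr expr2; ring. Qed.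

Lemma det_castmx_neq0 (R : fieldType) p q (E : p = q) (N : 'M[R]_(p, q)) :
  (forall w : 'rV_p, w *m N = 0 -> w = 0) -> \det (castmx (E, erefl q) N) != 0.
Proof.
subst q => H; rewrite castmx_id; apply/det0P => -[w w0 /H wN].
by rewrite wN eqxx in w0.
Qed.

(** A congruence multiplies the determinant by a positive square, and the normal form has exactly
    one entry -1. *)
Lemma det_lorentzian_lt0 (R : realType) m (G : 'M[R]_m.+1) :
  lorentzian_form G -> \det G < 0.
Proof.
move=> [P Pu E]; have := congr1 determinant E.
rewrite !det_mulmx det_tr det_diag big_ord_recl mxE /= big1 => [|i _]; last first.
  by rewrite mxE.
rewrite mulr1 mulrAC -expr2 => H.
have P0 : 0 < \det P ^+ 2.
  by rewrite lt_def sqr_ge0 andbT sqrf_eq0 -unitfE -unitmxE.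
by rewrite -(pmulr_rlt0 _ P0) H ltrN10.
Qed.

Lemma inner_rows (R : realType) p q m (G : 'M[R]_m)
    (A : 'M[R]_(p, m)) (B : 'M[R]_(q, m)) i j :
  inner G (row i A) (row j B) = (A *m G *m B^T) i j.
Proof. rewrite /inner tr_row -row_mul mxE [RHS]mxE.
by apply: eq_bigr => k _; rewrite mxE [col _ _ _ _]mxE. Qed.

Lemma inner_delta (R : realType) m (G : 'M[R]_m) i j :
  inner G (delta_mx 0 i) (delta_mx 0 j) = G i j.
Proof. by rewrite -!row1 inner_rows mul1mx trmx1 mulmx1. Qed.

Lemma inner_mull (R : realType) m (G A : 'M[R]_m) (X Y : 'rV[R]_m) :
  inner G (X *m A) Y = inner (A *m G) X Y.
Proof. by rewrite /inner !mulmxA. Qed.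

Section TangentForm.
Variables (R : realType) (n : nat) (gt : 'M[R]_n) (e : 'M[R]_n).
Hypothesis gtT : gt^T = gt.
Hypothesis e_on : orthonormal_frame gt e.

Lemma orthonormal_mx : e *m gt *m e^T = 1%:M.
Proof. by apply/matrixP => i j; rewrite -inner_rows e_on mxE. Qed.

(** A one-sided inverse of a square matrix is two-sided, so [e^T *m e] inverts [gt]; this converts
    sums over the frame into traces. *)
Lemma orthonormal_gram_inv : gt *m (e^T *m e) = 1%:M.
Proof.
have := orthonormal_mx; rewrite -mulmxA => /mulmx1C.
by rewrite -mulmxA.
Qed.

Lemma orthonormal_form_unit : gt \in unitmx.
Proof. by have [] := mulmx1_unit orthonormal_gram_inv. Qed.

Lemma orthonormal_det_gt0 : 0 < \det gt.
Proof.
have := congr1 determinant orthonormal_mx.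
rewrite !det_mulmx det_tr det1 mulrAC -expr2 => H.
have P0 : 0 < \det e ^+ 2.
  rewrite lt_def sqr_ge0 andbT; apply/eqP => E.
  by move: H; rewrite E mul0r => /eqP; rewrite eq_sym oner_eq0.
by rewrite -(pmulr_rgt0 _ P0) H ltr01.
Qed.

Lemma inner_op_inj (A B : 'M[R]_n) :
  (forall X Y : 'rV[R]_n, inner gt (X *m A) Y = inner gt (X *m B) Y) -> A = B.
Proof.
move=> H; rewrite -[LHS](mulmxK orthonormal_form_unit).
rewrite -[RHS](mulmxK orthonormal_form_unit); congr (_ *m _).
apply/matrixP => i j; have := H (delta_mx 0 i) (delta_mx 0 j).
by rewrite !inner_mull !inner_delta.
Qed.

Section SelfAdjoint.
Variable A : 'M[R]_n.
Hypothesis A_sa : self_adjoint gt A.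

(** The matrix of [A] in the orthonormal frame. It is symmetric, so the trace of its square is the
    sum of the squares of its entries. *)
Let T := e *m (A *m gt) *m e^T.

Let T_sym : T^T = T.
Proof.
have E : A *m gt = (A *m gt)^T.
  apply/matrixP => i j; rewrite [RHS]mxE -!inner_delta -!inner_mull.
  by rewrite A_sa inner_sym.
by rewrite /T 2!trmx_mul trmxK -E !mulmxA.
Qed.

Let tr_sqr : \tr (A *m A) = \sum_i \sum_j T i j ^+ 2.
Proof.
have TT : T *m T = e *m (A *m A *m gt *m e^T).
  rewrite /T !mulmxA -(mulmxA _ e^T e) -(mulmxA (e *m A) gt).
  by rewrite orthonormal_gram_inv mulmx1.
have -> : \tr (A *m A) = \tr (T *m T^T).
  by rewrite T_sym TT [RHS]mxtrace_mulC -!mulmxA orthonormal_gram_inv mulmx1.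
rewrite /mxtrace; apply: eq_bigr => i _; rewrite mxE.
by apply: eq_bigr => j _; rewrite [X in _ * X]mxE expr2.
Qed.

Lemma self_adjoint_tr_sqr_ge0 : 0 <= \tr (A *m A).
Proof. by rewrite tr_sqr; do 2!apply: sumr_ge0 => ? _; exact: sqr_ge0. Qed.

Lemma self_adjoint_tr_sqr_eq0 : \tr (A *m A) = 0 -> A = 0.
Proof.
rewrite tr_sqr => /eqP; rewrite psumr_eq0 => [/allP T0|i _]; last first.
  by apply: sumr_ge0 => ? _; exact: sqr_ge0.
have {}T0 : T = 0.
  apply/matrixP => i j; have /= := T0 i (mem_index_enum i).
  rewrite psumr_eq0 => [/allP/(_ j (mem_index_enum j))/=|? _]; last exact: sqr_ge0.
  by rewrite sqrf_eq0 => /eqP ->; rewrite mxE.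
have E : A = gt *m e^T *m T *m e.
  rewrite /T !mulmxA -(mulmxA gt e^T e) orthonormal_gram_inv mul1mx.
  by rewrite -!mulmxA orthonormal_gram_inv mulmx1.
by apply: etrans E _; rewrite T0 mulmx0 mul0mx.
Qed.

End SelfAdjoint.
End TangentForm.

(* In a basis of Gram matrix (p q; q r), (s,t) are the coordinates of xi and
   (s',t') those of its Hodge dual. *)
Lemma plane_hodge_norm (R : realFieldType) (p q r s t s' t' : R) :
  0 < q ^+ 2 - p * r ->
  s * (s' * p + t' * q) + t * (s' * q + t' * r) = 0 ->
  (s' * p + t' * q) ^+ 2 = t ^+ 2 * (q ^+ 2 - p * r) ->
  (s' * q + t' * r) ^+ 2 = s ^+ 2 * (q ^+ 2 - p * r) ->
  s' ^+ 2 * p + 2 * s' * t' * q + t' ^+ 2 * r =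
  - (s ^+ 2 * p + 2 * s * t * q + t ^+ 2 * r).
Proof.
move=> d0; set x1 := s' * p + t' * q; set x2 := s' * q + t' * r => E0 E1 E2.
have d1 : q ^+ 2 - p * r != 0 by rewrite gt_eqF.
(* The squares fix [x1] and [x2] only up to sign; the orthogonality [E0] fixes the sign of their
   product, which is all that the norm involves. *)
have E12 : x1 * x2 = - (s * t * (q ^+ 2 - p * r)).
  have [s0|s0] := eqVneq s 0.
    move: E2; rewrite s0 expr0n mul0r => /eqP; rewrite sqrf_eq0 => /eqP ->.
    by rewrite !(mulr0, mul0r) oppr0.
  apply: (mulfI s0); rewrite mulrA.
  have -> : s * x1 = - (t * x2) by apply/eqP; rewrite -subr_eq0 opprK E0.
  have -> : - (t * x2) * x2 = - t * x2 ^+ 2 by ring.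
  by rewrite E2; ring.
apply: (mulfI d1).
(* The norm expressed through the pairings [x1], [x2] with the basis, by the adjugate of the Gram
   matrix. *)
have -> : (q ^+ 2 - p * r) * (s' ^+ 2 * p + 2 * s' * t' * q + t' ^+ 2 * r) =
  2 * q * (x1 * x2) - r * x1 ^+ 2 - p * x2 ^+ 2 by rewrite /x1 /x2; ring.
by rewrite E12 E1 E2; ring.
Qed.

(** * Volume form and Hodge operator on the normal plane *)

Section NormalPlane.
Variables (R : realType) (n : nat).
Variables (gt : 'M[R]_n) (gn : 'M[R]_n.+2) (D : 'M[R]_(n, n.+2)).
Hypothesis gnT : gn^T = gn.
Hypothesis gn_lt0 : \det gn < 0.
Hypothesis gtE : gt = D *m gn *m D^T.
Hypothesis gt_gt0 : 0 < \det gt.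

Local Notation normal := (normal_vector gn D).
Local Notation ip := (inner gn).
Local Notation vol := (normal_volume gt gn D).
Local Notation star := (normal_hodge gt gn D).

Let gn_unit : gn \in unitmx.
Proof. by rewrite unitmxE unitfE lt_eqF. Qed.

Let gt_unit : gt \in unitmx.
Proof. by rewrite unitmxE unitfE gt_eqF. Qed.

Lemma normal_vectorP (v : 'rV[R]_n.+2) : normal v <-> v *m (gn *m D^T) = 0.
Proof.
split=> [H|H X]; last first.
  by rewrite inner_sym // /inner trmx_mul !mulmxA -(mulmxA v) H mul0mx mxE.
apply/rowP => i; have := H (delta_mx 0 i); rewrite inner_sym // /inner.
by rewrite -rowE tr_row -mulmxA colE !mulmxA -colE !mxE.
Qed.

(** The Gram matrix of the rows of [D], [u], [v] is block diagonal, with blocks [gt] and the Gram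
    matrix of [u], [v]. The minus sign comes from [\det gn < 0] under the absolute value in the
    volume. *)
Lemma normal_volume_sqr (u v : 'rV[R]_n.+2) : normal u -> normal v ->
  vol u v ^+ 2 = ip u v ^+ 2 - ip u u * ip v v.
Proof.
move=> /normal_vectorP Nu /normal_vectorP Nv; rewrite /normal_volume.
set C := col_mx u v; set N := col_mx D C.
have CD : C *m gn *m D^T = 0 by rewrite -mulmxA mul_col_mx Nu Nv col_mx0.
have DC : D *m gn *m C^T = 0.
  by rewrite -trmx0 -CD !trmx_mul trmxK gnT mulmxA.
have G : \det (C *m gn *m C^T) = ip u u * ip v v - ip u v ^+ 2.
  rewrite det_mx2 -!inner_rows.
  have -> : row 0 C = u.
    apply/rowP => j; rewrite !mxE; case: splitP => k // _.
    by rewrite (ord1 k).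
  have -> : row 1 C = v.
    apply/rowP => j; rewrite !mxE; case: splitP => k => [/(congr1 (leq^~ k))|_].
      by rewrite (ord1 k).
    by rewrite (ord1 k).
  by rewrite (inner_sym v u gnT) expr2.
have := det_castmx_gram (addn2 n) N gn.
rewrite {2 3}/N tr_col_mx mul_col_mx mul_col_row CD DC -gtE det_ublock G.
set d := \det _ => E.
rewrite exprMn exprMn exprVn !sqr_sqrtr ?normr_ge0 ?ltW // ltr0_norm //.
rewrite (_ : - \det gn / \det gt * d ^+ 2 = - (d ^+ 2 * \det gn) / \det gt); last first.
  by field; rewrite gt_eqF.
by rewrite E; field; rewrite gt_eqF.
Qed.

(** The normal space is the kernel of [gn *m D^T], of rank 2 because [D] has rank [n]. The positive
    quantity is the square of the volume of [a], [b], nonzero since together with the rows of [D]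
    they are independent. *)
Lemma normal_basis : exists a b : 'rV[R]_n.+2,
  [/\ normal a, normal b, 0 < ip a b ^+ 2 - ip a a * ip b b &
      forall v, normal v -> exists s t, v = s *: a + t *: b].
Proof.
pose K := kermx (gn *m D^T).
have rD : \rank D = n.
  apply/eqP; rewrite eqn_leq rank_leq_row /=.
  by rewrite -{1}(mxrank_unit gt_unit) gtE -mulmxA mxrankM_maxl.
have rK : \rank K = 2%N.
  rewrite mxrank_ker -mxrank_tr trmx_mul trmxK gnT mxrankMfree ?rD; last first.
    by rewrite row_free_unit.
  by rewrite -addn2 addKn.
have [N [NK Nfree]] : exists N : 'M[R]_(1 + 1, n.+2), (N :=: K)%MS /\ row_free N.
  have: (row_base K :=: K)%MS /\ row_free (row_base K).
    by split; [exact: eq_row_base|exact: row_base_free].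
  by move: (row_base K); rewrite rK => N HN; exists N.
have NN w : normal (w *m N).
  by apply/normal_vectorP/sub_kermxP; rewrite -/K -NK submxMl.
have Nr i : normal (row i N) by rewrite rowE.
pose a := usubmx N; pose b := dsubmx N.
have Na : normal a.
  have -> : a = row (lshift 1 0) N by apply/rowP => j; rewrite !mxE.
  exact: Nr.
have Nb : normal b.
  have -> : b = row (rshift 1 0) N by apply/rowP => j; rewrite !mxE.
  exact: Nr.
exists a, b; split => //.
  rewrite -normal_volume_sqr // lt_def sqr_ge0 andbT sqrf_eq0.
  rewrite /normal_volume mulf_neq0 //.
    by rewrite mulf_neq0 ?invr_eq0 // sqrtr_eq0 -ltNge ?normr_gt0 // lt_eqF.
  apply: det_castmx_neq0 => w; rewrite vsubmxK -[w]hsubmxK mul_row_col => H.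
  (* Pairing the relation with the tangent vectors kills its normal part and leaves the tangent
     coefficients times the invertible [gt]. *)
  have := congr1 (mulmx^~ (gn *m D^T)) H.
  rewrite mulmxDl mul0mx -mulmxA (mulmxA D) -gtE.
  have /normal_vectorP -> := NN (rsubmx w).
  rewrite addr0 => /(congr1 (mulmx^~ (invmx gt))); rewrite mulmxK // mul0mx => w1.
  move: H; rewrite w1 mul0mx add0r => /(congr1 (mulmx^~ (pinvmx N))).
  by rewrite mulmxKp // mul0mx => ->; rewrite row_mx0.
move=> v /normal_vectorP/sub_kermxP; rewrite -/K -NK => /submxP[w ->].
exists (lsubmx w 0 0), (rsubmx w 0 0).
rewrite -[in LHS](vsubmxK N) -{1}[w]hsubmxK mul_row_col -/a -/b.
by congr (_ + _); rewrite [X in X *m _]mx11_scalar mul_scalar_mx.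
Qed.

Let ip_l s t (a b v : 'rV[R]_n.+2) : ip (s *: a + t *: b) v = s * ip a v + t * ip b v.
Proof. by rewrite inner_linear_l -[t *: b]addr0 inner_linear_l {3}/inner !mul0mx mxE addr0. Qed.

Let ip_r s t (a b v : 'rV[R]_n.+2) : ip v (s *: a + t *: b) = s * ip v a + t * ip v b.
Proof. by rewrite inner_sym // ip_l !(inner_sym v). Qed.

(** The pairing of [star xi] with [v] is the volume of [xi], [v], whose square is known. At [v = xi]
    it vanishes; at the two basis vectors it supplies the data of [plane_hodge_norm]. *)
Lemma normal_hodge_plane (xi : 'rV[R]_n.+2) : normal xi ->
  ip (star xi) xi = 0 /\ ip (star xi) (star xi) = - ip xi xi.
Proof.
move=> Nxi; have [a [b [Na Nb d0 span]]] := normal_basis.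
have star0 : ip (star xi) xi = 0.
  rewrite normal_hodgeP //; apply/eqP; rewrite -sqrf_eq0 normal_volume_sqr //.
  by rewrite expr2 subrr.
split=> //.
have Nstar : normal (star xi) by exact: normal_hodge_normal.
have sqr_star v : normal v -> ip (star xi) v ^+ 2 = ip xi v ^+ 2 - ip xi xi * ip v v.
  by move=> Nv; rewrite normal_hodgeP // normal_volume_sqr.
have [s [t Exi]] := span _ Nxi; have [s' [t' Estar]] := span _ Nstar.
have := sqr_star _ Nb; have := sqr_star _ Na; move: star0.
rewrite Estar Exi !(ip_l, ip_r) (inner_sym b a gnT).
set p := ip a a; set q := ip a b; set r := ip b b => E0 E1 E2.
have H := @plane_hodge_norm _ p q r s t s' t' d0.
transitivity (s' ^+ 2 * p + 2 * s' * t' * q + t' ^+ 2 * r); first by ring.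
rewrite H; first by ring.
- by rewrite -E0; ring.
- by rewrite E1; ring.
- by rewrite E2; ring.
Qed.

(* The left-hand side is the Gram determinant of u, v, w, expanded along its
   first row. *)
Lemma normal_gram3 (u v w : 'rV[R]_n.+2) : normal u -> normal v -> normal w ->
  ip u u * (ip v v * ip w w - ip v w ^+ 2) - ip u v * (ip u v * ip w w - ip v w * ip u w)
  + ip u w * (ip u v * ip v w - ip v v * ip u w) = 0.
Proof.
have [a [b [Na Nb d0 span]]] := normal_basis.
move=> /span[s1 [t1 ->]] /span[s2 [t2 ->]] /span[s3 [t3 ->]].
by rewrite !(ip_l, ip_r) (inner_sym b a gnT); ring.
Qed.

(** Were [u] orthogonal to both basis vectors, its coordinates would solve a homogeneous system with
    the Gram matrix, whose determinant is nonzero. *)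
Lemma normal_nondegenerate (u : 'rV[R]_n.+2) : normal u -> u != 0 ->
  exists2 v, normal v & ip u v = 1.
Proof.
move=> Nu u0; have [a [b [Na Nb d0 span]]] := normal_basis.
suff [v Nv vu] : exists2 v, normal v & ip u v != 0.
  (* The summand [0 *: v] only brings the vector into the shape expected by [ip_r]. *)
  exists ((ip u v)^-1 *: v + 0 *: v); last by rewrite ip_r mul0r addr0 mulVf.
  by move=> X; rewrite ip_r (Nv X) !mulr0 addr0.
have [ua|] := eqVneq (ip u a) 0; last by exists a.
have [ub|] := eqVneq (ip u b) 0; last by exists b.
have [s [t E]] := span _ Nu; move: ua ub u0.
rewrite E !ip_l (inner_sym b a gnT).
set p := ip a a in d0 *; set q := ip a b in d0 *; set r := ip b b in d0 * => E1 E2.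
have d1 : q ^+ 2 - p * r != 0 by rewrite gt_eqF.
have -> : s = 0.
  apply: (mulfI d1); rewrite mulr0.
  have -> : (q ^+ 2 - p * r) * s = q * (s * q + t * r) - r * (s * p + t * q) by ring.
  by rewrite E1 E2; ring.
have -> : t = 0.
  apply: (mulfI d1); rewrite mulr0.
  have -> : (q ^+ 2 - p * r) * t = q * (s * p + t * q) - p * (s * q + t * r) by ring.
  by rewrite E1 E2; ring.
by rewrite !scale0r addr0 eqxx.
Qed.

(** The norm of [star u] does not decide this, as [u] may be null. If [star u = 0], the squared
    volume formula gives equality in Cauchy-Schwarz for [u] and every normal vector; polarised on a
    basis this makes [u] null, hence orthogonal to the whole plane. *)
Lemma normal_hodge_neq0 (u : 'rV[R]_n.+2) : normal u -> u != 0 -> star u != 0.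
Proof.
move=> Nu u0; have [v Nv uv] := normal_nondegenerate Nu u0.
apply/eqP => S0.
have sq w : normal w -> ip u w ^+ 2 = ip u u * ip w w.
  move=> Nw; apply/eqP; rewrite -subr_eq0 -normal_volume_sqr // -normal_hodgeP //.
  by rewrite S0 /inner !mul0mx mxE expr0n.
have [a [b [Na Nb d0 span]]] := normal_basis.
(* The sum of the basis vectors, for polarisation. *)
have Nab : normal (1 *: a + 1 *: b) by move=> X; rewrite ip_r Na Nb !mulr0 addr0.
have Ea := sq _ Na; have Eb := sq _ Nb; have Eab := sq _ Nab.
rewrite !(ip_l, ip_r) (inner_sym b a gnT) in Eab.
have Eq : ip u a * ip u b = ip u u * ip a b.
  have : (1 * ip u a + 1 * ip u b) ^+ 2 =
      ip u a ^+ 2 + ip u b ^+ 2 + 2 * (ip u a * ip u b) by ring.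
  rewrite Eab Ea Eb; lra.
have : ip u u ^+ 2 * (ip a b ^+ 2 - ip a a * ip b b) = 0.
  have -> : ip u u ^+ 2 * (ip a b ^+ 2 - ip a a * ip b b) =
    (ip u u * ip a b) ^+ 2 - (ip u u * ip a a) * (ip u u * ip b b) by ring.
  by rewrite -Eq -Ea -Eb; ring.
move/eqP; rewrite mulf_eq0 sqrf_eq0 (gt_eqF d0) orbF => /eqP uu.
by have := sq _ Nv; rewrite uv uu mul0r expr1n => /eqP; rewrite oner_eq0.
Qed.

(** Both [v] and [star u] lie in the kernel of the nonzero linear form [ip u] on a plane, so the
    determinant of their coordinates vanishes; [star u] being nonzero, [v] is a multiple of it. *)
Lemma normal_orthogonal (u v : 'rV[R]_n.+2) : normal u -> u != 0 -> normal v ->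
  ip v u = 0 -> exists c : R, v = c *: star u.
Proof.
move=> Nu u0 Nv vu; have [a [b [Na Nb d0 span]]] := normal_basis.
have Nstar : normal (star u) by exact: normal_hodge_normal.
have star0 := normal_hodge_neq0 Nu u0; have [star_u _] := normal_hodge_plane Nu.
have [w Nw uw] := normal_nondegenerate Nu u0.
have [s2 [t2 Ev]] := span _ Nv; have [s' [t' Estar]] := span _ Nstar.
have [s3 [t3 Ew]] := span _ Nw.
rewrite inner_sym // Ew ip_l !(inner_sym _ u) // in uw.
rewrite Ev ip_l !(inner_sym _ u) // in vu.
rewrite Estar ip_l !(inner_sym _ u) // in star_u.
set f1 := ip u a in uw vu star_u; set f2 := ip u b in uw vu star_u.
have cross : s2 * t' = t2 * s'.
  have e1 : (s2 * t' - t2 * s') * f1 = 0.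
    have -> : (s2 * t' - t2 * s') * f1 =
      t' * (s2 * f1 + t2 * f2) - t2 * (s' * f1 + t' * f2) by ring.
    by rewrite vu star_u; ring.
  have e2 : (s2 * t' - t2 * s') * f2 = 0.
    have -> : (s2 * t' - t2 * s') * f2 =
      s2 * (s' * f1 + t' * f2) - s' * (s2 * f1 + t2 * f2) by ring.
    by rewrite vu star_u; ring.
  apply/eqP; rewrite -subr_eq0; apply/eqP.
  (* The vector [w] dual to [u] ensures that [f1] and [f2] do not both vanish. *)
  rewrite -[LHS]mulr1 -uw.
  have -> : (s2 * t' - t2 * s') * (s3 * f1 + t3 * f2) =
    s3 * ((s2 * t' - t2 * s') * f1) + t3 * ((s2 * t' - t2 * s') * f2) by ring.
  by rewrite e1 e2; ring.
rewrite Ev Estar.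
have [s0|s0] := eqVneq s' 0.
  have t0 : t' != 0.
    by apply: contraNneq star0 => t0; rewrite Estar s0 t0 !scale0r addr0.
  exists (t2 / t'); rewrite scalerDr !scalerA divfK //; congr (_ *: _ + _).
  by apply: (mulIf t0); rewrite cross s0; ring.
exists (s2 / s'); rewrite scalerDr !scalerA divfK //; congr (_ + _ *: _).
by apply: (mulIf s0); rewrite -cross; field.
Qed.

End NormalPlane.

(** * Shear operators *)

Section Shear.
Variables (R : realType) (n : nat).
Variables (gt : 'M[R]_n) (gn : 'M[R]_n.+2) (D : 'M[R]_(n, n.+2)).
Variables (h : 'rV[R]_n -> 'rV[R]_n -> 'rV[R]_n.+2) (e : 'M[R]_n).
Hypothesis n_gt0 : (0 < n)%N.
Hypothesis gtT : gt^T = gt.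
Hypothesis gnT : gn^T = gn.
Hypothesis gn_lt0 : \det gn < 0.
Hypothesis gtE : gt = D *m gn *m D^T.
Hypothesis e_on : orthonormal_frame gt e.
Hypothesis h_linear : forall a (u v w : 'rV[R]_n), h (a *: u + v) w = a *: h u w + h v w.
Hypothesis h_sym : forall u v, h u v = h v u.
Hypothesis h_normal : forall u v, normal_vector gn D (h u v).

Local Notation normal := (normal_vector gn D).
Local Notation ip := (inner gn).
Local Notation star := (normal_hodge gt gn D).
Local Notation shape := (shape_operator gt gn h).
Local Notation shear := (shear_operator gt gn h).
Local Notation theta := (expansion gt gn h).
Local Notation H := (mean_curvature h e).
Local Notation hs := (total_shear gt h e).

Let gt_gt0 : 0 < \det gt. Proof. exact: orthonormal_det_gt0 e_on. Qed.
Let gt_unit : gt \in unitmx. Proof. exact: orthonormal_form_unit e_on. Qed.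
Let n0 : n%:R != 0 :> R. Proof. by rewrite pnatr_eq0 -lt0n. Qed.

Let ip0l w : ip 0 w = 0. Proof. by rewrite /inner !mul0mx mxE. Qed.
Let ipZl a u v : ip (a *: u) v = a * ip u v.
Proof. by rewrite -[a *: u]addr0 inner_linear_l ip0l addr0. Qed.
Let ipDl u v w : ip (u + v) w = ip u w + ip v w.
Proof. by rewrite -{1}[u]scale1r inner_linear_l mul1r. Qed.
Let ip_suml I (r : seq I) (F : I -> 'rV[R]_n.+2) w :
  ip (\sum_(i <- r) F i) w = \sum_(i <- r) ip (F i) w.
Proof. by elim/big_rec2: _ => [|i y1 y2 _ <-]; rewrite ?ip0l ?ipDl. Qed.

Let h_coord u v : h u v =
  \sum_i \sum_j (u 0 i * v 0 j) *: h (delta_mx 0 i) (delta_mx 0 j).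
Proof.
have h0 w : h 0 w = 0.
  (* Linearity with coefficient -1 at zero vectors forces [h 0 w = 0]. *)
  by have := h_linear (-1) 0 0 w; rewrite scaler0 addr0 scaleN1r addNr.
have hZ a u' w : h (a *: u') w = a *: h u' w.
  by rewrite -[a *: u']addr0 h_linear h0 addr0.
have hD u' v' w : h (u' + v') w = h u' w + h v' w.
  by rewrite -{1}[u']scale1r h_linear scale1r.
have h_expand u' w : h u' w = \sum_i u' 0 i *: h (delta_mx 0 i) w.
  rewrite {1}(row_sum_delta u') (big_morph (h^~ w) (fun a b => hD a b w) (h0 w)).
  by apply: eq_bigr => i _; rewrite hZ.
rewrite h_expand; apply: eq_bigr => i _; rewrite h_sym h_expand scaler_sumr.
by apply: eq_bigr => j _; rewrite scalerA h_sym.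
Qed.

Lemma shapeP xi (X Y : 'rV[R]_n) : inner gt (X *m shape xi) Y = ip (h X Y) xi.
Proof.
apply: shape_operatorP => // {X Y} X Y; rewrite h_coord ip_suml.
apply: eq_bigr => i _; rewrite ip_suml; apply: eq_bigr => j _.
by rewrite ipZl.
Qed.

(** The trace of the shape operator is computed in the frame [e]; in particular the pairing of [H]
    with [xi] does not depend on that frame. *)
Lemma expansionE xi : theta xi = n%:R * ip H xi.
Proof.
rewrite /mean_curvature ipZl mulrA divff // mul1r ip_suml.
have -> : \sum_i ip (h (row i e) (row i e)) xi = \tr (e *m (shape xi *m gt) *m e^T).
  apply: eq_bigr => i _; rewrite -inner_rows -shapeP /inner.
  by rewrite !mulmxA.
rewrite mxtrace_mulC !mulmxA mxtrace_mulC !mulmxA -(mulmxA gt).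
by rewrite orthonormal_gram_inv // mul1mx.
Qed.

Lemma shearP xi (X Y : 'rV[R]_n) : inner gt (X *m shear xi) Y = ip (hs X Y) xi.
Proof.
rewrite /shear_operator mulmxBr mul_mx_scalar /total_shear expansionE.
rewrite mulrA mulVf // mul1r.
rewrite -!scaleNr [X in inner gt X]addrC inner_linear_l shapeP ipDl.
rewrite (ipZl (- inner gt X Y)).
ring.
Qed.

Lemma mxtrace_shear xi : \tr (shear xi) = 0.
Proof.
rewrite /shear_operator linearB /= mxtrace_scalar -[X in _ - X]mulr_natl mulrA divff //.
by rewrite mul1r subrr.
Qed.

Lemma umbilicalP xi : umbilical gt gn h xi <-> shear xi = 0.
Proof.
split=> [[c E]|/eqP].
  rewrite /shear_operator /expansion E mxtrace_scalar -[c *+ n]mulr_natl mulrA mulVf //.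
  by rewrite mul1r subrr.
by rewrite subr_eq0 => /eqP E; eexists; exact: E.
Qed.

(** Splitting the shape operator into its trace-free and scalar parts, the cross terms have trace
    zero. *)
Lemma mxtrace_shape_sqr xi :
  \tr (shape xi *m shape xi) = \tr (shear xi *m shear xi) + n%:R * ip H xi ^+ 2.
Proof.
have -> : shape xi = shear xi + (ip H xi)%:M.
  by rewrite /shear_operator expansionE mulrA mulVf // mul1r subrK.
move: (shear xi) (mxtrace_shear xi) (ip H xi) => S trS c.
rewrite mulmxDl !mulmxDr -scalar_mxM !linearD /= mul_mx_scalar mul_scalar_mx !linearZ /=.
by rewrite trS mxtrace_scalar -[(c * c) *+ n]mulr_natl !mulr0; ring.
Qed.

Lemma shear_self_adjoint xi : self_adjoint gt (shear xi).
Proof.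
move=> X Y; rewrite [RHS]inner_sym // !shearP /total_shear h_sym.
by rewrite (inner_sym X).
Qed.

Lemma mean_curvature_normal : normal H.
Proof.
move=> X; rewrite inner_sym // ipZl ip_suml big1 ?mulr0 // => i _.
by rewrite inner_sym // h_normal.
Qed.

Lemma total_shear_normal X Y : normal (hs X Y).
Proof.
move=> Z; rewrite inner_sym // /total_shear ipDl -scaleNr ipZl !(inner_sym _ (Z *m D)) //.
by rewrite h_normal mean_curvature_normal mulr0 addr0.
Qed.

(* The total shear is orthogonal to xi, hence a multiple of star xi; pairing with
   an eta dual to star xi identifies the coefficient as the shear operator of
   eta. When that operator vanishes, G = 0 and any A of the right trace works. *)
Lemma exists_shear_vector xi : normal xi -> xi != 0 -> umbilical gt gn h xi ->
  exists G, shear_vector gt gn D h e G.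
Proof.
move=> Nxi xi0 /umbilicalP shear0.
have gn_unit : gn \in unitmx by rewrite unitmxE unitfE lt_eqF.
have Nstar : normal (star xi) by exact: normal_hodge_normal.
have star0 : star xi != 0 by exact: normal_hodge_neq0.
have [eta Neta star_eta] := normal_nondegenerate gnT gn_lt0 gtE gt_gt0 Nstar star0.
have hsE X Y : hs X Y = inner gt (X *m shear eta) Y *: star xi.
  have [|c E] := normal_orthogonal gnT gn_lt0 gtE gt_gt0 Nxi xi0 (total_shear_normal X Y).
    by rewrite -shearP shear0 mulmx0 /inner !mul0mx mxE.
  by rewrite E shearP E ipZl star_eta mulr1.
have S_sa := shear_self_adjoint eta.
have [S0|Sn0] := eqVneq (\tr (shear eta *m shear eta)) 0.
  have {}S0 := self_adjoint_tr_sqr_eq0 gtT e_on S_sa S0.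
  exists 0; split; first by move=> X; rewrite inner_sym // ip0l.
  (* The square of this operator is [n] times the identity, of trace [n ^ 2]. *)
  exists (Num.sqrt n%:R)%:M; split.
  - by move=> X Y; rewrite !mul_mx_scalar /inner linearZ /= -!scalemxAl -scalemxAr.
  - by rewrite -scalar_mxM mxtrace_scalar -expr2 sqr_sqrtr // -[LHS]mulr_natl expr2.
  - by move=> X Y; rewrite hsE S0 mulmx0 /inner !mul0mx mxE scale0r scaler0.
have S_gt0 : 0 < \tr (shear eta *m shear eta).
  by rewrite lt_def Sn0 (self_adjoint_tr_sqr_ge0 gtT e_on).
(* This factor normalises the trace of the squared operator to [n ^ 2]; the vector absorbs its
   inverse. *)
pose c := n%:R / Num.sqrt (\tr (shear eta *m shear eta)).
have c0 : c != 0 by rewrite mulf_neq0 // invr_eq0 sqrtr_eq0 -ltNge.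
exists (c^-1 *: star xi); split.
  by move=> X; rewrite inner_sym // ipZl inner_sym // Nstar mulr0.
exists (c *: shear eta); split.
- move=> X Y; rewrite -!scalemxAr /inner linearZ /= -!scalemxAl -scalemxAr.
  by rewrite [LHS]mxE [RHS]mxE; congr (_ * _); exact: S_sa.
- rewrite -scalemxAl -scalemxAr scalerA linearZ /= -expr2 expr_div_n sqr_sqrtr ?ltW //.
  by rewrite divfK.
- move=> X Y; rewrite hsE -scalemxAr scalerA; congr (_ *: _).
  by rewrite /inner -!scalemxAl [X in _ = X / _]mxE mulrAC divff // mul1r.
Qed.

Section ShearVector.
Variables (G : 'rV[R]_n.+2) (A : 'M[R]_n).
Hypothesis trA : \tr (A *m A) = n%:R ^+ 2.
Hypothesis hsE : forall X Y, hs X Y = inner gt (X *m A) Y *: G.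

Lemma shear_vectorE xi : shear xi = ip G xi *: A.
Proof.
apply: (inner_op_inj e_on) => X Y; rewrite shearP hsE ipZl.
by rewrite -scalemxAr /inner -!scalemxAl [RHS]mxE mulrC.
Qed.

Lemma shear_vector_op_neq0 : A != 0.
Proof.
apply: contra_eq_neq trA => ->.
by rewrite mul0mx linear0 eq_sym sqrf_eq0.
Qed.

End ShearVector.

(** Both factorisations give the same shear operators. Evaluated at a vector dual to [G] they make
    [A] a multiple [c] of [A']; equal traces force [c ^+ 2 = 1], and nondegeneracy then gives
    [G' = c *: G]. *)
Lemma shear_vector_uniq G G' : shear_vector gt gn D h e G ->
  shear_vector gt gn D h e G' -> G' = G \/ G' = - G.
Proof.
move=> [NG [A [_ trA EA]]] [NG' [A' [_ trA' EA']]].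
have E xi : ip G xi *: A = ip G' xi *: A'.
  by rewrite -(shear_vectorE EA) -(shear_vectorE EA').
(* If [G1 = 0] but [G2] is nonzero, a vector dual to [G2] yields [A2 = 0], against its trace. *)
have zero G1 (A1 : 'M[R]_n) G2 (A2 : 'M[R]_n) : normal G2 -> \tr (A2 *m A2) = n%:R ^+ 2 ->
   (forall xi, ip G1 xi *: A1 = ip G2 xi *: A2) -> G1 = 0 -> G2 = 0.
  move=> N2 tr2 E12 G10; apply/eqP/negPn/negP => G20.
  have [v Nv Gv] := normal_nondegenerate gnT gn_lt0 gtE gt_gt0 N2 G20.
  have := E12 v; rewrite G10 ip0l scale0r Gv scale1r => A20.
  by have := shear_vector_op_neq0 tr2; rewrite -A20 eqxx.
have [G0|G0] := eqVneq G 0.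
  by left; rewrite G0; apply: (zero _ _ _ _ NG' trA' E).
have [v Nv Gv] := normal_nondegenerate gnT gn_lt0 gtE gt_gt0 NG G0.
pose c := ip G' v; have AE : A = c *: A' by rewrite -[A]scale1r -Gv E.
have c2 : c ^+ 2 = 1.
  have n20 : n%:R ^+ 2 != 0 :> R by rewrite expf_neq0.
  apply: (mulIf n20); rewrite mul1r -[in RHS]trA AE -scalemxAl -scalemxAr scalerA.
  by rewrite linearZ /= trA' expr2.
have GE : G' = c *: G.
  apply/eqP; rewrite -subr_eq0; apply/negPn/negP => d0.
  have Nd : normal (G' - c *: G).
    move=> X; rewrite inner_sym // ipDl -scaleNr ipZl !(inner_sym _ (X *m D)) //.
    by rewrite NG NG' mulr0 addr0.
  have [w Nw] := normal_nondegenerate gnT gn_lt0 gtE gt_gt0 Nd d0.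
  rewrite ipDl -scaleNr ipZl => dw.
  have := E w; rewrite AE scalerA => /eqP; rewrite -subr_eq0 -scalerBl scaler_eq0.
  rewrite (negPf (shear_vector_op_neq0 trA')) orbF subr_eq0 => /eqP Ew.
  by move/eqP: dw; rewrite -Ew mulrC mulNr addrC addNr eq_sym oner_eq0.
move/eqP: c2; rewrite sqrf_eq1 => /orP[]/eqP c1; rewrite GE c1.
  by left; rewrite scale1r.
by right; rewrite scaleN1r.
Qed.

(** Since [A] is nonzero, the shear operator of [xi] vanishes exactly when [xi] is orthogonal to
    [G]. *)
Lemma umbilical_direction G xi : shear_vector gt gn D h e G -> G != 0 ->
  normal xi /\ umbilical gt gn h xi <-> exists c : R, xi = c *: star G.
Proof.
move=> [NG [A [_ trA EA]]] G0.
have gn_unit : gn \in unitmx by rewrite unitmxE unitfE lt_eqF.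
have Nstar : normal (star G) by exact: normal_hodge_normal.
have [starG _] := normal_hodge_plane gnT gn_lt0 gtE gt_gt0 NG.
split=> [[Nxi /umbilicalP]|[c ->]].
  rewrite (shear_vectorE EA) => /eqP.
  rewrite scaler_eq0 (negPf (shear_vector_op_neq0 trA)) orbF => /eqP Gxi.
  by apply: normal_orthogonal => //; rewrite inner_sym.
split; first by move=> X; rewrite inner_sym // ipZl inner_sym // Nstar mulr0.
apply/umbilicalP; rewrite (shear_vectorE EA) inner_sym // ipZl starG mulr0.
by rewrite scale0r.
Qed.

(** The vanishing Gram determinant of [v], [k], [l], solved for the norm of [v]. *)
Lemma normal_norm_null_frame k l v : null_normal_frame gn D k l -> normal v ->
  ip v v = - (2 * (ip v k * ip v l)).
Proof.
move=> [Nk Nl kk ll kl] Nv.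
have := normal_gram3 gnT gn_lt0 gtE gt_gt0 Nv Nk Nl.
rewrite kk ll kl => E; apply/eqP; rewrite -subr_eq0 -oppr_eq0; apply/eqP.
by rewrite -[RHS]E; ring.
Qed.

(** Again the Gram determinant. Multiplying by the product of the two norms, each of square 1,
    avoids deciding which frame vector is timelike. *)
Lemma normal_norm_orthonormal_frame xi1 xi2 v :
  orthonormal_normal_frame gn D xi1 xi2 -> normal v ->
  ip v v = ip xi1 xi1 * ip v xi1 ^+ 2 + ip xi2 xi2 * ip v xi2 ^+ 2.
Proof.
move=> [N1 N2 x12 x1 x2] Nv.
have := normal_gram3 gnT gn_lt0 gtE gt_gt0 Nv N1 N2; rewrite x12.
have sq (y : R) : `|y| = 1 -> y * y = 1.
  by move=> y1; rewrite -expr2 -real_normK ?num_real // y1 expr1n.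
move: (sq _ x1) (sq _ x2); set p := ip xi1 xi1; set q := ip xi2 xi2 => pp qq E.
have {}E : (p * q) * (ip v v * (p * q) - q * ip v xi1 ^+ 2 - p * ip v xi2 ^+ 2) = 0.
  by rewrite -[RHS](mulr0 (p * q)) -E; ring.
move/eqP: E; rewrite !mulrBr -!addrA -opprD subr_eq0 => /eqP.
have -> : p * q * (ip v v * (p * q)) = (p * p) * (q * q) * ip v v by ring.
have -> : p * q * (q * ip v xi1 ^+ 2) + p * q * (p * ip v xi2 ^+ 2) =
  p * (q * q) * ip v xi1 ^+ 2 + (p * p) * q * ip v xi2 ^+ 2 by ring.
by rewrite pp qq !mulr1 !mul1r.
Qed.

(** * Traces in terms of the norm of G *)

Section Causal.
Variables (G k l xi1 xi2 : 'rV[R]_n.+2).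
Hypothesis G_shear : shear_vector gt gn D h e G.
Hypothesis kl : null_normal_frame gn D k l.
Hypothesis xi12 : orthonormal_normal_frame gn D xi1 xi2.

Lemma shear_vector_hodge_norm : ip (star G) (star G) = - ip G G.
Proof.
have [NG _] := G_shear.
by have [] := normal_hodge_plane gnT gn_lt0 gtE gt_gt0 NG.
Qed.

Lemma op_inner_shear : op_inner (shear k) (shear l) = - (n%:R ^+ 2 / 2 * ip G G).
Proof.
have [NG [A [_ trA EA]]] := G_shear.
rewrite /op_inner !(shear_vectorE EA) -scalemxAl -scalemxAr scalerA linearZ /= trA.
by rewrite (normal_norm_null_frame kl NG); field.
Qed.

Lemma mxtrace_shear_casorati :
  \tr (shear_casorati gt gn h xi1 xi2) = n%:R ^+ 2 * ip G G.
Proof.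
have [NG [A [_ trA EA]]] := G_shear.
rewrite /shear_casorati !(shear_vectorE EA) -!scalemxAl -!scalemxAr !scalerA.
rewrite linearD !linearZ /= trA (normal_norm_orthonormal_frame xi12 NG); ring.
Qed.

(** The scalar parts of the shape operators contribute [n] times the expansion of the norm of [H] in
    the normal frame. *)
Lemma mxtrace_casorati : \tr (casorati gt gn h xi1 xi2) =
  \tr (shear_casorati gt gn h xi1 xi2) + n%:R * ip H H.
Proof.
rewrite (normal_norm_orthonormal_frame xi12 mean_curvature_normal).
rewrite /casorati /shear_casorati !mxtraceD !mxtraceZ !mxtrace_shape_sqr.
ring.
Qed.

End Causal.
End Shear.

(** * From charts to the pointwise statement *)

Lemma nbhs_local_rep_domain (R : realType) n m (S M : topologicalType)
    (mS : manifold R n S) (mM : manifold R m M) (Phi : S -> M)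
    (p : S) (i : chart_index mS) (j : chart_index mM) :
  continuous Phi -> chart_dom i p -> chart_dom j (Phi p) ->
  \forall z \near chart i p, (chart i @` (chart_dom i `&` Phi @^-1` chart_dom j)) z.
Proof.
move=> cPhi ip jp; have ix : (chart i @` chart_dom i) (chart i p) by exists p.
have O : nbhs (chart_inv i (chart i p)) (chart_dom i `&` Phi @^-1` chart_dom j).
  rewrite chart_invK //; apply: open_nbhs_nbhs; split=> //.
  apply: openI; first exact: chart_dom_open.
  by apply: open_comp => [q _|]; [exact: cPhi|exact: chart_dom_open].
(* Near the point, [chart_inv i] lands in the required domain; as [z] also lies in the open chart
   image, it is the image of [chart_inv i z]. *)
have H1 := chart_inv_continuous ix O.
have H2 := open_nbhs_nbhs (conj (@chart_img_open _ _ _ mS i) ix).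
near=> z.
have [q iq zq] : (chart i @` chart_dom i) z by near: z; exact: H2.
have : (chart_dom i `&` Phi @^-1` chart_dom j) (chart_inv i z) by near: z; exact: H1.
by rewrite -zq chart_invK // => iqj; exists q.
Unshelve. all: by end_near. Qed.

Theorem mainTheorem3 (R : realType) (n : nat) (n_gt0 : (0 < n)%N)
    (S M : topologicalType) (mS : manifold R n S) (mM : manifold R n.+2 M)
    (oS : oriented mS) (oM : oriented mM)
    (g : metric mS) (gbar : metric mM)
    (g_riem : riemannian g) (gbar_lor : lorentzian gbar)
    (Phi : S -> M) (Phi_iso : isometric_immersion g gbar Phi)
    (* a point of S, with charts at it and at its image *)
    (p : S) (i : chart_index mS) (j : chart_index mM)
    (ip : chart_dom i p) (jp : chart_dom j (Phi p)) :
  let F := local_rep Phi i j in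
  let x := chart i p in
  let gt := gmx g i x in
  let gn := gmx gbar j (F x) in
  let D := jacobian F x in
  let h := second_fundamental_form (gmx gbar j) F x in
  let star := normal_hodge gt gn D in
  forall (e : 'M[R]_n), orthonormal_frame gt e ->
  let H := mean_curvature h e in
  (exists xi, [/\ normal_vector gn D xi, xi != 0 & umbilical gt gn h xi]) ->
  (exists G, shear_vector gt gn D h e G) /\
  (forall G G', shear_vector gt gn D h e G -> shear_vector gt gn D h e G' ->
     G' = G \/ G' = - G) /\
  (forall G, shear_vector gt gn D h e G ->
    (G != 0 -> forall xi, normal_vector gn D xi /\ umbilical gt gn h xi <->
                          exists c : R, xi = c *: star G) /\
    (forall k l xi1 xi2 : 'rV[R]_n.+2,
       null_normal_frame gn D k l -> orthonormal_normal_frame gn D xi1 xi2 ->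
       let AkAl := op_inner (shear_operator gt gn h k)
                            (shear_operator gt gn h l) in
       let trJ := \tr (shear_casorati gt gn h xi1 xi2) in
       let trB := \tr (casorati gt gn h xi1 xi2) in
       let nHH := n%:R * inner gn H H in
       [/\ inner gn (star G) (star G) = - (n%:R ^+ 2)^-1 * trJ,
           - (n%:R ^+ 2)^-1 * trJ = 2%:R / n%:R ^+ 2 * AkAl &
           2%:R / n%:R ^+ 2 * AkAl = - (n%:R ^+ 2)^-1 * (trB - nHH)] /\
       [/\ [/\ AkAl < 0 <-> 0 < trJ, 0 < trJ <-> nHH < trB &
               AkAl < 0 -> timelike gn (star G)],
           [/\ 0 < AkAl <-> trJ < 0, trJ < 0 <-> trB < nHH &
               0 < AkAl -> spacelike gn (star G)] &
           [/\ AkAl = 0 <-> trJ = 0, trJ = 0 <-> trB = nHH &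
               AkAl = 0 -> null gn (star G)]])).
Proof.
move=> F x gt gn D h star e e_on H [xi0 [Nxi0 xi00 umb0]].
have [[cPhi smPhi] isoPhi] := Phi_iso.
have nU := nbhs_local_rep_domain cPhi ip jp.
have Ux := nbhs_singleton nU.
have ix : (chart i @` chart_dom i) x by exists p.
have jFx : (chart j @` chart_dom j) (F x).
  by exists (Phi p) => //; rewrite /F /local_rep /= chart_invK.
(* Two orders suffice: [dU] is differentiability of [F], and [ddU] contains that of its partial
   derivatives. *)
have [dU ddU] := smPhi i j 2%N.
have dF : \forall z \near x, differentiable F z by apply: filterS nU.
have ddF a : differentiable (fun z => 'D_(delta_mx 0 a) F z) x.
  by have [dda _] := ddU a; exact: dda.
have [dgb _] := @metric_smooth _ _ _ _ gbar j 1%N.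
have {}dgb := dgb _ jFx.
have gb_sym : \forall z \near F x, (gmx gbar j z)^T = gmx gbar j z.
  apply: filterS (open_nbhs_nbhs (conj (@chart_img_open _ _ _ mM j) jFx)).
  by move=> z jz; exact: (@Defs.metric_sym _ _ _ _ gbar j z jz).
have gnT : gn^T = gn := nbhs_singleton gb_sym.
have gtT : gt^T = gt by exact: (@Defs.metric_sym _ _ _ _ g i x ix).
have [_ gtE] := isoPhi i j x Ux.
have gn_lt0 : \det gn < 0 by exact/det_lorentzian_lt0/gbar_lor.
have h_normal X Y : normal_vector gn D (h X Y).
  apply: normal_part_normal => //; rewrite /F -gtE.
  exact: orthonormal_form_unit e_on.
have h_lin : forall a (u v w : 'rV[R]_n), h (a *: u + v) w = a *: h u w + h v w.
  by move=> a u v w; exact: second_fundamental_form_linear.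
have h_sym : forall u v, h u v = h v u.
  by move=> u v; exact: second_fundamental_form_sym.
split.
  exact: (exists_shear_vector n_gt0 gtT gnT gn_lt0 gtE e_on h_lin h_sym h_normal
    Nxi0 xi00 umb0).
split.
  move=> G G' HG HG'.
  exact: (shear_vector_uniq n_gt0 gnT gn_lt0 gtE e_on h_lin h_sym HG HG').
move=> G HG; split.
  move=> G0 xi.
  exact: (umbilical_direction n_gt0 gnT gn_lt0 gtE e_on h_lin h_sym xi HG G0).
move=> k l xi1 xi2 kl xi12 AkAl trJ trB nHH.
have E1 : AkAl = - (n%:R ^+ 2 / 2 * inner gn G G).
  exact: (op_inner_shear n_gt0 gnT gn_lt0 gtE e_on h_lin h_sym HG kl).
have E2 : trJ = n%:R ^+ 2 * inner gn G G.
  exact: (mxtrace_shear_casorati n_gt0 gnT gn_lt0 gtE e_on h_lin h_sym HG xi12).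
have E3 : trB = trJ + nHH.
  exact: (mxtrace_casorati n_gt0 gnT gn_lt0 gtE e_on h_lin h_sym h_normal xi12).
have E4 : inner gn (star G) (star G) = - inner gn G G.
  exact: (shear_vector_hodge_norm gnT gn_lt0 gtE e_on HG).
rewrite /timelike /spacelike /null E3 E4 E1 E2.
have N0 : 0 < n%:R ^+ 2 :> R by rewrite exprn_gt0 // ltr0n.
(* Only real arithmetic remains: with [N > 0], the four quantities are [- (N / 2 * z)], [N * z],
   [N * z + w] and [- z]. *)
move: (n%:R ^+ 2) (inner gn G G) N0 nHH {E1 E2 E3 E4} => N z N0 w.
split; first by split; field; rewrite gt_eqF.
have N2 : 0 < N / 2 by rewrite divr_gt0.
have Nz0 : N * z = 0 <-> z = 0.
  by split=> [/eqP|->]; rewrite ?mulr0 // mulf_eq0 gt_eqF // => /eqP.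
rewrite -(subr_gt0 w) -(subr_lt0 w) addrK oppr_lt0 oppr_gt0.
rewrite !(pmulr_rgt0 _ N2, pmulr_rlt0 _ N2, pmulr_rgt0 _ N0, pmulr_rlt0 _ N0).
rewrite oppr_lt0 oppr_gt0; split; split=> //.
- split=> [/eqP|/Nz0 ->]; last by rewrite mulr0 oppr0.
  by rewrite oppr_eq0 mulf_eq0 gt_eqF //= => /eqP /Nz0.
- by split=> [->|/eqP]; rewrite ?add0r // -subr_eq0 addrK => /eqP.
- by move=> /eqP; rewrite oppr_eq0 mulf_eq0 gt_eqF //= => /eqP ->; rewrite oppr0.
Qed.
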